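(* For every non-negative integer $n$ there is an integer $a(n)$ such that every finite acyclically indecomposable tournament with at least $a(n)$ vertices contains a subtournament isomorphic to a member of $\check{\mathfrak B}_{\underline n}:=\{\check T : T\in\mathfrak B_{\underline n}\}$, where $\mathfrak B_{\underline n}=\{C_3.\underline n,\ V_{[\underline n]},\ T_{[\underline n]},\ U_{[\underline n]},\ H_{[\underline n]},\ K_{[\underline n]}\}$.
   Context: A tournament is a set with an irreflexive, antisymmetric, complete binary relation (edges, written $u\to v$); it is acyclic if it has no $3$-cycle. A subset of vertices is autonomous if every vertex outside it either dominates all of it or is dominated by all of it. A tournament is acyclically indecomposable if no autonomous subset inducing an acyclic tournament has more than one element. For a vertex $x$ of a tournament $T$, the acyclic component of $x$ is the union of all acyclic autonomous subsets containing $x$ (it is the largest acyclic autonomous set containing $x$); acyclic components partition $V(T)$. $\check T$ denotes the tournament whose vertices are the acyclic components of $T$, with $X\to Y$ iff $X\neq Y$ and $x\to y$ in $T$ for some (equivalently all) $x\in X,y\in Y$. $\underline n$ is the chain $(\{0,\dots,n-1\},<)$. For a chain $C=(A,<)$: - $C_3.C$: vertex set $A\times\{0,1,2\}$, $(x,i)\to(y,j)$ iff $x<y$, or $x=y$ and $j\equiv i+1\pmod 3$. - $V_{[C]}$: vertex set $(A\times\{0,1\})\cup\{a\}$, $a$ new; $(x,i)\to(x',i')$ iff $x<x'$ or ($x=x'$ and $i<i'$); $a\to(x,0)$ and $(x,1)\to a$ for all $x$. - $T_{[C]},U_{[C]},H_{[C]},K_{[C]}$: vertex set $A\times\{0,1\}$;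 in all four $(x,0)\to(x,1)$ for all $x$ and $(x,0)\to(y,0)$ for $x<y$; additionally for all $x<y$: $T_{[C]}$: $(x,1)\to(y,1)$, $(y,1)\to(x,0)$, $(y,0)\to(x,1)$; $U_{[C]}$: $(y,1)\to(x,1)$, $(x,0)\to(y,1)$, $(x,1)\to(y,0)$; $H_{[C]}$: $(x,1)\to(y,1)$, $(y,1)\to(x,0)$, $(x,1)\to(y,0)$; $K_{[C]}$: $(y,1)\to(x,1)$, $(y,1)\to(x,0)$, $(x,1)\to(y,0)$. *)

(* Defs.v *)
From mathcomp Require Import all_boot all_order.

Set Implicit Arguments.
Unset Strict Implicit.
Unset Printing Implicit Defensive.

Import Order.TTheory.

Record tournament := Tournament {
  vertex :> finType;
  edge : rel vertex;
  edge_irr : irreflexive edge;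
  edge_anti : antisymmetric edge;
  edge_complete : forall x y, x != y -> edge x y || edge y x
}.

Definition isomorphic (S T : tournament) : Prop :=
  exists2 f : S -> T, bijective f & forall x y, edge (f x) (f y) = edge x y.

Section Subtournament.
Variables (T : tournament) (X : {set T}).

Definition sub_edge : rel {x | x \in X} := fun u v => edge (val u) (val v).

Lemma sub_edge_irr : irreflexive sub_edge.
Proof. by move=> u; apply: edge_irr. Qed.

Lemma sub_edge_anti : antisymmetric sub_edge.
Proof. by move=> u v /edge_anti /val_inj. Qed.

Lemma sub_edge_complete u v : u != v -> sub_edge u v || sub_edge v u.
Proof. by move=> uv; apply: edge_complete; rewrite (inj_eq val_inj). Qed.

Definition subtournament : tournament :=
  Tournament sub_edge_irr sub_edge_anti sub_edge_complete.

End Subtournament.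

Definition contains (T S : tournament) : Prop :=
  exists X : {set T}, isomorphic (subtournament X) S.

Definition acyclic (T : tournament) : bool :=
  ~~ [exists x : T, exists y : T, exists z : T,
        [&& edge x y, edge y z & edge z x]].

Definition autonomous (T : tournament) (X : {set T}) : bool :=
  [forall z : T, (z \notin X) ==>
     [forall x in X, edge z x] || [forall x in X, edge x z]].

Definition acyclic_autonomous (T : tournament) (X : {set T}) : bool :=
  autonomous X && acyclic (subtournament X).

Definition acyclically_indecomposable (T : tournament) : Prop :=
  forall X : {set T}, acyclic_autonomous X -> #|X| <= 1.

Definition acyclic_component (T : tournament) (x : T) : {set T} :=
  \bigcup_(X : {set T} | acyclic_autonomous X && (x \in X)) X.

Definition acyclic_components (T : tournament) : {set {set T}} :=
  [set acyclic_component x | x : T].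

Section ComponentTheory.
Variable T : tournament.
Implicit Types (x y z : T) (X Y : {set T}).

Lemma edge_asym x y : edge x y -> edge y x = false.
Proof.
move=> xy; apply/negP => yx; have e : x = y by apply: edge_anti; rewrite xy yx.
by move: xy; rewrite e edge_irr.
Qed.

Lemma edgeN x y : x != y -> edge y x = ~~ edge x y.
Proof.
move=> /edge_complete; case xy: (edge x y) => //= _.
exact: edge_asym.
Qed.

Lemma acyclic_subP X :
  reflect (forall x y z, x \in X -> y \in X -> z \in X ->
             ~ [/\ edge x y, edge y z & edge z x])
          (acyclic (subtournament X)).
Proof.
apply: (iffP idP) => [ac x y z xX yX zX [xy yz zx]|ac].
  case/negP: ac; apply/existsP; exists (Sub x xX).
  by apply/existsP; exists (Sub y yX); apply/existsP; exists (Sub z zX); apply/and3P.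
apply/negP => /existsP[u /existsP[v /existsP[w /and3P[uv vw wu]]]].
by apply: (ac (val u) (val v) (val w) (valP u) (valP v) (valP w)).
Qed.

Lemma autonomousP X :
  reflect (forall z x y, z \notin X -> x \in X -> y \in X -> edge z x = edge z y)
          (autonomous X).
Proof.
apply: (iffP forallP) => [au z x y zX xX yX|au z].
  have /implyP/(_ zX) := au z.
  case/orP => /forall_inP h; first by rewrite !h.
  by rewrite (edge_asym (h x xX)) (edge_asym (h y yX)).
apply/implyP => zX; have [->|[x xX]] := set_0Vmem X.
  by apply/orP; left; apply/forall_inP => x; rewrite inE.
case zx: (edge z x); apply/orP; [left|right]; apply/forall_inP => y yX.
  by rewrite -(au z x y).
rewrite (@edgeN z y) -?(au z x y) ?zx //.
by apply: contraNneq zX => ->.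
Qed.

Lemma acyclic_autonomousU X Y x : x \in X -> x \in Y ->
  acyclic_autonomous X -> acyclic_autonomous Y -> acyclic_autonomous (X :|: Y).
Proof.
move=> xX xY /andP[/autonomousP auX /acyclic_subP acX].
move=> /andP[/autonomousP auY /acyclic_subP acY].
have two (A : {set T}) :
    (forall z x y, z \notin A -> x \in A -> y \in A -> edge z x = edge z y) ->
    forall a b c, a \in A -> b \in A -> edge a b -> edge b c -> edge c a -> c \in A.
  move=> auA a b c aA bA ab bc ca; case: (boolP (c \in A)) => // cA.
  by have := auA c a b cA aA bA; rewrite ca (edge_asym bc).
apply/andP; split.
  apply/autonomousP => z a b; rewrite inE negb_or => /andP[zX zY] aXY bXY.
  have h c : c \in X :|: Y -> edge z c = edge z x.
    by case/setUP => cA; [apply: auX | apply: auY].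
  by rewrite !h.
apply/acyclic_subP => a b c /setUP ha /setUP hb /setUP hc [ab bc ca].
have tX := two _ auX; have tY := two _ auY.
suff [[aA bA cA]|[aA bA cA]] :
    [/\ a \in X, b \in X & c \in X] \/ [/\ a \in Y, b \in Y & c \in Y].
- exact: (acX a b c).
- exact: (acY a b c).
case: ha hb hc => [aA|aA] [bA|bA] [cA|cA]; (try by left); (try by right).
- by left; split=> //; apply: (tX a b).
- by left; split=> //; apply: (tX c a).
- by right; split=> //; apply: (tY b c).
- by left; split=> //; apply: (tX b c).
- by right; split=> //; apply: (tY c a).
- by right; split=> //; apply: (tY a b).
Qed.

Lemma acyclic_autonomous1 x : acyclic_autonomous [set x].
Proof.
apply/andP; split.
  by apply/autonomousP => z a b _ /set1P-> /set1P->.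
by apply/acyclic_subP => a b c /set1P-> /set1P-> _ []; rewrite edge_irr.
Qed.

Lemma acyclic_component_max X x :
  acyclic_autonomous X -> x \in X -> X \subset acyclic_component x.
Proof. by move=> aX xX; apply: bigcup_sup; rewrite aX. Qed.

Lemma mem_acyclic_component x : x \in acyclic_component x.
Proof.
by apply: (subsetP (acyclic_component_max (acyclic_autonomous1 x) (set11 x))); rewrite set11.
Qed.

Lemma acyclic_component_aa x : acyclic_autonomous (acyclic_component x).
Proof.
pose C := \bigcup_(X : {set T} | acyclic_autonomous X && (x \in X)) X.
have /andP[] : acyclic_autonomous (x |: C) && (x \in x |: C).
  rewrite /C; elim/big_rec: _ => [|X Y /andP[aX xX] /andP[aY xY]].
    by rewrite setU0 acyclic_autonomous1 set11.
  rewrite setUCA; apply/andP; split; last by rewrite inE xX.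
  exact: (acyclic_autonomousU xX xY).
suff -> : x |: C = acyclic_component x by [].
by apply/setUidPr; rewrite sub1set mem_acyclic_component.
Qed.

Lemma acyclic_component_eq x y :
  y \in acyclic_component x -> acyclic_component y = acyclic_component x.
Proof.
move=> yx.
have s := acyclic_component_max (acyclic_component_aa x) yx.
apply/eqP; rewrite eqEsubset s andbT.
apply: (acyclic_component_max (acyclic_component_aa y)).
exact: (subsetP s _ (mem_acyclic_component x)).
Qed.

Lemma acyclic_components_partition : partition (acyclic_components T) [set: T].
Proof.
apply/and3P; split.
- apply/eqP/setP => x; rewrite inE; apply/bigcupP.
  by exists (acyclic_component x); [apply: imset_f | apply: mem_acyclic_component].
- apply/trivIsetP => _ _ /imsetP[x _ ->] /imsetP[y _ ->] xy.
  rewrite -setI_eq0; apply/eqP/setP => z; rewrite !inE.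
  apply: contraNF xy => /andP[zx zy].
  by rewrite -(acyclic_component_eq zx) -(acyclic_component_eq zy).
- apply/imsetP => -[x _ e].
  by have := mem_acyclic_component x; rewrite -e inE.
Qed.

End ComponentTheory.

Section Check.
Variable T : tournament.

Definition check_edge : rel {X | X \in acyclic_components T} := fun X Y =>
  (X != Y) && [exists x in val X, exists y in val Y, edge x y].

Lemma acyclic_components_autonomous (X : {set T}) :
  X \in acyclic_components T -> autonomous X.
Proof. by case/imsetP=> x _ ->; case/andP: (acyclic_component_aa x). Qed.

Lemma check_edge_all (X Y : {X | X \in acyclic_components T}) (x y : T) :
  X != Y -> x \in val X -> y \in val Y -> check_edge X Y = edge x y.
Proof.
move=> XY xX yY.
have /and3P[_ /trivIsetP tr _] := acyclic_components_partition T.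
have dXY : [disjoint val X & val Y] by apply: tr (valP X) (valP Y) XY.
have aaX := acyclic_components_autonomous (valP X).
have aaY := acyclic_components_autonomous (valP Y).
have same a b : a \in val X -> b \in val Y -> edge a b = edge x y.
  move=> aX bY.
  have ->: edge a b = edge a y.
    by apply: (autonomousP _ aaY) => //; rewrite (disjointFr dXY).
  have yX : y \notin val X by rewrite (disjointFl dXY).
  have ne c : c \in val X -> y != c by move=> cX; apply: contraNneq yX => ->.
  rewrite (edgeN (ne a aX)) (edgeN (ne x xX)); congr (~~ _).
  exact: (autonomousP _ aaX).
rewrite /check_edge XY /=; apply/exists_inP/idP => [[a aX /exists_inP[b bY ab]]|xy].
  by rewrite -(same a b).
by exists x => //; apply/exists_inP; exists y.
Qed.

Lemma check_mem (X : {X | X \in acyclic_components T}) : exists x, x \in val X.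
Proof. by case: X => X /= /imsetP[x _ ->]; exists x; apply: mem_acyclic_component. Qed.

Lemma check_edge_irr : irreflexive check_edge.
Proof. by move=> X; rewrite /check_edge eqxx. Qed.

Lemma check_edge_anti : antisymmetric check_edge.
Proof.
move=> X Y; have [//|XY] := eqVneq X Y.
have [x xX] := check_mem X; have [y yY] := check_mem Y.
rewrite (check_edge_all XY xX yY) (check_edge_all _ yY xX) 1?eq_sym //.
by case/andP => /edge_asym->.
Qed.

Lemma check_edge_complete X Y : X != Y -> check_edge X Y || check_edge Y X.
Proof.
move=> XY; have [x xX] := check_mem X; have [y yY] := check_mem Y.
have YX : Y != X by rewrite eq_sym.
rewrite (check_edge_all XY xX yY) (check_edge_all YX yY xX).
apply: edge_complete; apply: contra_neq XY => e; apply: val_inj.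
rewrite -{}e in yY.
have /imsetP[x' _ eX] := valP X; have /imsetP[y' _ eY] := valP Y.
move: xX yY; rewrite eX eY.
by move=> /acyclic_component_eq <- /acyclic_component_eq <-.
Qed.

Definition check : tournament :=
  Tournament check_edge_irr check_edge_anti check_edge_complete.

End Check.

(* In the constructions below a boolean second coordinate stands for an
   element of {0, 1}, with false = 0 and true = 1.  *)
Section Families.
Local Open Scope order_scope.
Variables (d : Order.disp_t) (C : finOrderType d).

Definition C3_edge : rel (C * 'I_3) := fun u v =>
  let: (x, i) := u in let: (y, j) := v in
  (x < y) || ((x == y) && (j == i.+1 %[mod 3])%N).

(* The added vertex a is None.  *)
Definition V_edge : rel (option (C * bool)) := fun u v =>
  match u, v with
  | Some (x, i), Some (y, j) => (x < y) || [&& x == y, ~~ i & j]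
  | None, Some (_, j) => ~~ j
  | Some (_, i), None => i
  | None, None => false
  end.

(* The edges between distinct x and y are listed in the order (x,0) to (y,0),
   (x,1) to (y,1), (x,1) to (y,0), (x,0) to (y,1), whatever the order of x
   and y.  A rule such as "(y,1) -> (x,0) for all x < y" thus reads y < x in
   the third line.  *)
Definition T_edge : rel (C * bool) := fun u v =>
  let: (x, i) := u in let: (y, j) := v in
  if x == y then ~~ i && j else
  match i, j with
  | false, false => x < y
  | true, true => x < y
  | true, false => y < x
  | false, true => y < x
  end.

Definition U_edge : rel (C * bool) := fun u v =>
  let: (x, i) := u in let: (y, j) := v in
  if x == y then ~~ i && j else
  match i, j with
  | false, false => x < y
  | true, true => y < x
  | true, false => x < y
  | false, true => x < y
  end.

(* In H and K every (x,1) dominates every (y,0) with y != x.  *)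
Definition H_edge : rel (C * bool) := fun u v =>
  let: (x, i) := u in let: (y, j) := v in
  if x == y then ~~ i && j else
  match i, j with
  | false, false => x < y
  | true, true => x < y
  | true, false => true
  | false, true => false
  end.

Definition K_edge : rel (C * bool) := fun u v =>
  let: (x, i) := u in let: (y, j) := v in
  if x == y then ~~ i && j else
  match i, j with
  | false, false => x < y
  | true, true => y < x
  | true, false => true
  | false, true => false
  end.

Lemma C3_edge_irr : irreflexive C3_edge.
Proof. by case=> x [[|[|[|//]]] hi] /=; rewrite ltxx eqxx. Qed.

Lemma C3_edge_anti : antisymmetric C3_edge.
Proof.
case=> [x [i hi]] [y [j hj]] /=.
case: (ltgtP x y) => //= e.
by move: hi hj; case: i => [|[|[|//]]] hi; case: j => [|[|[|//]]] hj.
Qed.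

Lemma C3_edge_complete u v : u != v -> C3_edge u v || C3_edge v u.
Proof.
case: u v => [x [i hi]] [y [j hj]] /=; rewrite xpair_eqE.
case: (ltgtP x y) => //= e.
by move: hi hj; case: i => [|[|[|//]]] hi; case: j => [|[|[|//]]] hj.
Qed.

Definition C3_of : tournament := Tournament C3_edge_irr C3_edge_anti C3_edge_complete.

Lemma V_edge_irr : irreflexive V_edge.
Proof. by case=> [[x [|]]|] //=; rewrite ltxx eqxx. Qed.

Lemma V_edge_anti : antisymmetric V_edge.
Proof. by case=> [[x [|]]|] [[y [|]]|] //=; case: ltgtP => //= ->. Qed.

Lemma V_edge_complete u v : u != v -> V_edge u v || V_edge v u.
Proof.
case: u v => [[x i]|] [[y j]|] //=; last by case: j.
  have [->|ne] := eqVneq x y; last by case: ltgtP ne.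
  rewrite ltxx /=; case: i j => [] [] //=; by rewrite eqxx.
by case: i.
Qed.

Definition V_of : tournament := Tournament V_edge_irr V_edge_anti V_edge_complete.

Lemma T_edge_irr : irreflexive T_edge.
Proof. by case=> x [] /=; rewrite eqxx. Qed.

Lemma T_edge_anti : antisymmetric T_edge.
Proof. by case=> [x []] [y []] //=; case: (ltgtP x y) => //= ->. Qed.

Lemma T_edge_complete : forall u v, u != v -> T_edge u v || T_edge v u.
Proof.
by case=> [x []] [y []] //=; rewrite xpair_eqE; case: (ltgtP x y).
Qed.

Definition T_of : tournament := Tournament T_edge_irr T_edge_anti T_edge_complete.

Lemma U_edge_irr : irreflexive U_edge.
Proof. by case=> x [] /=; rewrite eqxx. Qed.

Lemma U_edge_anti : antisymmetric U_edge.
Proof. by case=> [x []] [y []] //=; case: (ltgtP x y) => //= ->. Qed.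

Lemma U_edge_complete : forall u v, u != v -> U_edge u v || U_edge v u.
Proof.
by case=> [x []] [y []] //=; rewrite xpair_eqE; case: (ltgtP x y).
Qed.

Definition U_of : tournament := Tournament U_edge_irr U_edge_anti U_edge_complete.

Lemma H_edge_irr : irreflexive H_edge.
Proof. by case=> x [] /=; rewrite eqxx. Qed.

Lemma H_edge_anti : antisymmetric H_edge.
Proof. by case=> [x []] [y []] //=; case: (ltgtP x y) => //= ->. Qed.

Lemma H_edge_complete : forall u v, u != v -> H_edge u v || H_edge v u.
Proof.
by case=> [x []] [y []] //=; rewrite xpair_eqE; case: (ltgtP x y).
Qed.

Definition H_of : tournament := Tournament H_edge_irr H_edge_anti H_edge_complete.

Lemma K_edge_irr : irreflexive K_edge.
Proof. by case=> x [] /=; rewrite eqxx. Qed.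

Lemma K_edge_anti : antisymmetric K_edge.
Proof. by case=> [x []] [y []] //=; case: (ltgtP x y) => //= ->. Qed.

Lemma K_edge_complete : forall u v, u != v -> K_edge u v || K_edge v u.
Proof.
by case=> [x []] [y []] //=; rewrite xpair_eqE; case: (ltgtP x y).
Qed.

Definition K_of : tournament := Tournament K_edge_irr K_edge_anti K_edge_complete.

End Families.

(* The chain n is 'I_n with its canonical order, which is < on nat.  *)
Inductive frakB (n : nat) : tournament -> Prop :=
| frakB_C3 : frakB n (C3_of 'I_n)
| frakB_V : frakB n (V_of 'I_n)
| frakB_T : frakB n (T_of 'I_n)
| frakB_U : frakB n (U_of 'I_n)
| frakB_H : frakB n (H_of 'I_n)
| frakB_K : frakB n (K_of 'I_n).

(* Main.v *)
(* By Ramsey's theorem a large tournament contains a long transitive chain D,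
   and one may take D maximal under insertion of a vertex.  By acyclic
   indecomposability each pair x_i < y_i of consecutive vertices of D is
   separated by some z_i.  If x_i -> z_i -> y_i, maximality of D gives a vertex
   w_i of D such that z_i cannot be inserted between x_i and y_i: either
   y_i < w_i -> z_i, or z_i -> w_i < x_i.  Apply Ramsey's theorem to the tuples
   (x_i, y_i, z_i, w_i) and call the result homogeneous.  Two homogeneous
   sequences u, v with u_i -> v_i yield T, U, H or K unless u_i -> v_j for all
   i <> j, or they form one increasing or one decreasing chain
   u_0 v_0 u_1 v_1 ... (up to orientation).  In the remaining configurations the
   chain x_0 y_0 x_1 y_1 ..., together with these alternatives for the other
   rows, gives V (a single z_k or w_k alternates along a chain) or three
   interleaved rows, that is C_3.n. *)
Require Import Defs.
From mathcomp Require Import all_boot all_order.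
From mathcomp Require Import zify.

Set Implicit Arguments.
Unset Strict Implicit.
Unset Printing Implicit Defensive.

(** * Containment from edge-preserving maps *)

Lemma edge_neq (T : tournament) (x y : T) : edge x y -> x != y.
Proof. by move=> xy; apply: contraTneq xy => ->; rewrite edge_irr. Qed.

(** Completeness makes an edge-preserving map injective and edge-reflecting. *)
Lemma embedding_contains (S T : tournament) (f : S -> T) :
  (forall x y, edge x y -> edge (f x) (f y)) -> contains T S.
Proof.
move=> fE.
have fI : injective f.
  move=> x y fxy; apply/eqP; apply: contraT => /edge_complete.
  by case/orP=> /fE; rewrite fxy edge_irr.
have fEe x y : edge (f x) (f y) = edge x y.
  have [->|xy] := eqVneq x y; first by rewrite !edge_irr.
  case e: (edge x y); first exact: fE.
  by apply: edge_asym; apply: fE; rewrite (edgeN xy) e.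
pose X := [set f x | x in S].
have inX x : f x \in X by apply: imset_f.
pose g (x : S) : subtournament X := Sub (f x) (inX x).
have gI : injective g by move=> x y /(congr1 val) /fI.
have cX : #|{: subtournament X}| <= #|S|.
  by rewrite card_sig (leq_trans _ (leq_imset_card f S)) // subset_leq_card.
have [h gK hK] := inj_card_bij gI cX.
exists X; exists h; first by exists g.
by move=> u v; rewrite -{2}[u]hK -{2}[v]hK -fEe.
Qed.

(** One vertex chosen in each acyclic component embeds [check S] in [S], so it suffices to map the
    members of [frakB] themselves. *)
Lemma contains_check (S T : tournament) (f : S -> T) :
  (forall x y, edge x y -> edge (f x) (f y)) -> contains T (check S).
Proof.
move=> fE.
apply: (@embedding_contains _ _ (fun X : check S => f (xchoose (check_mem X)))) => X Y XY.
apply: fE; rewrite -(@check_edge_all _ X Y) ?(edge_neq XY) //; exact: xchooseP.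
Qed.

(** * Configurations of two and three homogeneous sequences *)

Section Sequences.
Variable T : tournament.
Implicit Types (u v w x y z : nat -> T) (b : bool).

(* The value b = false stands for the reversed edges, so that arcs b u v m also
   implies u i <> v j for i < j < m. *)
Definition arcs b u v m :=
  forall i j, i < j -> j < m -> if b then edge (u i) (v j) else edge (v j) (u i).

Lemma arcs_le b u v m m' : m' <= m -> arcs b u v m -> arcs b u v m'.
Proof. by move=> le A i j ij jm; apply: A => //; apply: leq_trans le. Qed.

Lemma arcs_rev b u v m : arcs b u v m ->
  arcs (~~ b) (fun i => v (m.-1 - i)) (fun i => u (m.-1 - i)) m.
Proof.
move=> A i j ij jm; have := A (m.-1 - j) (m.-1 - i).
by case: b {A} => A; apply: A; lia.
Qed.

Definition has_B n := exists2 B, frakB n B & contains T (check B).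

Lemma has_V n a u v :
  arcs true u u n -> arcs true v v n -> arcs true u v n -> arcs true v u n ->
  (forall i, i < n -> [/\ edge (u i) (v i), edge a (u i) & edge (v i) a]) ->
  has_B n.
Proof.
move=> uu vv uv vu A; exists (V_of 'I_n); first by constructor.
pose f (s : V_of 'I_n) := if s is Some (i, b) then (if b then v else u) i else a.
apply: (@contains_check _ _ f) => [[[i b]|] [[j c]|]] //=; last first.
- by case: c => // _; case: (A j).
- by case: b => // _; case: (A i).
case/orP=> [ij|/and3P[/eqP-> /negPf-> ->]]; last by case: (A j).
by case: b c => [] []; [apply: vv|apply: vu|apply: uv|apply: uu].
Qed.

Lemma has_C3 n u v w :
  arcs true u u n -> arcs true v v n -> arcs true w w n ->
  arcs true u v n -> arcs true v u n -> arcs true v w n ->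
  arcs true w v n -> arcs true w u n -> arcs true u w n ->
  (forall i, i < n -> [/\ edge (u i) (v i), edge (v i) (w i) & edge (w i) (u i)]) ->
  has_B n.
Proof.
move=> uu vv ww uv vu vw wv wu uw A; exists (C3_of 'I_n); first by constructor.
pose f (s : C3_of 'I_n) := nth u [:: u; v; w] s.2 s.1.
apply: (@contains_check _ _ f) => -[i [b hb]] [j [c hc]] /=.
rewrite /f /=; case/orP=> [ij|/andP[/eqP-> ]].
  by case: b c hb hc => [|[|[|//]]] [|[|[|//]]] _ _ /=; auto.
have [? ? ?] := A j (ltn_ord j).
by case: b c hb hc => [|[|[|//]]] [|[|[|//]]].
Qed.

(** Here [u] supplies the vertices [(x, 0)] and [v] the vertices [(x, 1)]; the four triples are
    those of [T], [U], [H] and [K], in this order. *)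
Lemma has_pair n b c d u v :
  arcs true u u n -> arcs b v v n -> arcs c u v n -> arcs d v u n ->
  (forall i, i < n -> edge (u i) (v i)) ->
  (b, c, d) \in [:: (true, false, false); (false, true, true);
                    (true, false, true); (false, false, true)] ->
  has_B n.
Proof.
move=> uu vv uv vu A.
pose f (s : 'I_n * bool) := (if s.2 then v else u) s.1.
rewrite !inE; case/or4P=> /eqP[? ? ?]; subst b c d;
  [exists (T_of 'I_n); [exact: frakB_T | apply: (@contains_check (T_of 'I_n) T f)]
  |exists (U_of 'I_n); [exact: frakB_U | apply: (@contains_check (U_of 'I_n) T f)]
  |exists (H_of 'I_n); [exact: frakB_H | apply: (@contains_check (H_of 'I_n) T f)]
  |exists (K_of 'I_n); [exact: frakB_K | apply: (@contains_check (K_of 'I_n) T f)]];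
  move=> -[i b] [j c] /=;
  rewrite /f /=; (have [->|] := eqVneq i j; first by case: b c => [] [] //= _; apply: A);
  rewrite -(inj_eq val_inj) neq_ltn; case/orP=> ij; case: b c => [] [] //= h;
  (try by first [exact: uu | exact: vv | exact: uv | exact: vu]);
  by move: h; rewrite ltEord ltnNge (ltnW ij).
Qed.

(* Pairing v (2i) with u (2i + 1) turns the edges u i -> v i around. *)
Lemma pair_cases_shift n m u v : 2 * n <= m ->
  arcs false u u m -> arcs true v v m -> arcs true u v m -> arcs true v u m ->
  has_B n.
Proof.
move=> le uu vv uv vu.
apply: (@has_pair n false true true (fun i => v (2 * i)) (fun i => u (2 * i).+1)).
- by move=> i j ij jn; apply: vv; lia.
- by move=> i j ij jn; apply: uu; lia.
- by move=> i j ij jn; apply: vu; lia.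
- by move=> i j ij jn; apply: uv; lia.
- by move=> i jn; apply: vu; lia.
- by [].
Qed.

(** Reversing the indices negates [a] and [b] and turns [(c, d)] into [(~~ d, ~~ c)], so [a = true]
    may be assumed. Then [(b, c, d)] is a triple of [has_pair], falls under the last two
    alternatives, or is all false; the last pattern, reversed, is that of [pair_cases_shift]. *)
Lemma pair_cases n m a b c d u v : 2 * n <= m ->
  arcs a u u m -> arcs b v v m -> arcs c u v m -> arcs d v u m ->
  (forall i, i < m -> edge (u i) (v i)) ->
  [\/ has_B n, c = true /\ d = false | [/\ b = a, c = a & d = a]].
Proof.
move=> le uu vv uv vu A.
have le' : n <= m by lia.
have direct (p q r : bool) (s t : nat -> T) : arcs true s s m -> arcs p t t m ->
    arcs q s t m -> arcs r t s m -> (forall i, i < m -> edge (s i) (t i)) ->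
    (p, q, r) \in [:: (true, false, false); (false, true, true);
                    (true, false, true); (false, false, true)] -> has_B n.
  move=> ss tt st ts E; apply: has_pair (arcs_le le' ss) (arcs_le le' tt)
    (arcs_le le' st) (arcs_le le' ts) _ => i im; apply: E; lia.
have := (arcs_rev uu, arcs_rev vv, arcs_rev uv, arcs_rev vu).
have A' i : i < m -> edge (u (m.-1 - i)) (v (m.-1 - i)) by move=> im; apply: A; lia.
case: a uu => uu; case: b vv => vv; case: c uv => uv; case: d vu => vu [[[uu' vv'] uv'] vu'];
 first [by constructor 2|by constructor 3|constructor 1];
 first [exact: direct uu vv uv vu A _ | exact: direct uu' vv' vu' uv' A' _
   | exact: pair_cases_shift le uu vv uv vu
   | exact: pair_cases_shift le uu' vv' vu' uv' ].
Qed.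

(* With c = true both alternatives of pair_cases give u i -> v j for all i <= j. *)
Lemma cycle_has_B n m b c1 d1 c2 d2 p q z : 2 * n < m ->
  arcs true p p m -> arcs true q q m -> arcs true p q m -> arcs true q p m ->
  arcs b z z m -> arcs c1 q z m -> arcs d1 z q m -> arcs c2 z p m -> arcs d2 p z m ->
  (forall i, i < m -> [/\ edge (p i) (q i), edge (q i) (z i) & edge (z i) (p i)]) ->
  has_B n.
Proof.
move=> le pp qq pq qp zz qz zq zp pz A.
have le2 : 2 * n <= m by lia.
have len : n <= m by lia.
have Aqz i : i < m -> edge (q i) (z i) by case/A.
have Azp i : i < m -> edge (z i) (p i) by case/A.
have Apq i : i < m -> edge (p i) (q i) by case/A.
have V a : (forall i, i < n -> edge a (p i) /\ edge (q i) a) -> has_B n.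
  move=> Aa; apply: (@has_V n a p q); try exact: arcs_le len _.
  by move=> i im; have [] := Aa i im; split=> //; apply: Apq; apply: leq_trans len.
have [//|[? ?]|[? ? ?]] := pair_cases le2 zz pp zp pz Azp;
have [//|[? ?]|[? ? ?]] := pair_cases le2 qq zz qz zq Aqz; subst.
(* [C_3] arises if [z] interleaves with both [p] and [q]. Otherwise [z 0], or [z n] if only [q]
   interleaves with [z], dominates every [p i] and is dominated by every [q i] with [i < n]. *)
all: try by apply: (has_C3 (arcs_le len pp) (arcs_le len qq) (arcs_le len zz));
  try exact: arcs_le len _; move=> i im; apply: A; lia.
all: try by apply: (V (z 0)) => i im; case: i im => [|i] im;
   [split; [apply: Azp|apply: Aqz]; lia | split; [apply: zp; lia | apply: zq; lia]].
by apply: (V (z n)) => i im; split; [apply: pz|apply: qz]; lia.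
Qed.

(** If [z] interleaves with both [x] and [y], all five bits are true. In the other cases left by
    [pair_cases], a single [z k] alternates along the chain [y 0, x 1, y 1, x 2, ...]. *)
Lemma between_cases n m b c1 d1 c2 d2 x y z : 2 * n + 1 < m ->
  arcs true x x m -> arcs true y y m -> arcs true x y m -> arcs true y x m ->
  arcs b z z m -> arcs c1 x z m -> arcs d1 z x m -> arcs c2 z y m -> arcs d2 y z m ->
  (forall i, i < m -> edge (x i) (y i)) ->
  (forall i, i < m -> edge (x i) (z i)) -> (forall i, i < m -> edge (z i) (y i)) ->
  has_B n \/ [&& b, c1, d1, c2 & d2].
Proof.
move=> le xx yy xy yx zz xz zx zy yz Axy Axz Azy.
have le2 : 2 * n <= m by lia.
have V a : (forall i, i < n -> edge a (y i) /\ edge (x i.+1) a) -> has_B n.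
  move=> Aa; apply: (@has_V n a y (fun i => x i.+1)).
  - by move=> i j ij im; apply: yy; lia.
  - by move=> i j ij im; apply: xx; lia.
  - by move=> i j ij im; apply: yx; lia.
  - by move=> i j ij im; have [->|ne] := eqVneq i.+1 j; [apply: Axy|apply: xy]; lia.
  by move=> i im; have [] := Aa i im; split=> //; apply: yx => //; lia.
have [|[? ?]|[? ? ?]] := pair_cases le2 xx zz xz zx Axz; first (by left);
have [|[? ?]|[? ? ?]] := pair_cases le2 zz yy zy yz Azy; try (by left); subst;
  last by right.
all: left.
- apply: (V (z 0)) => i im; split; last by apply: zx; lia.
  by case: i im => [|i] im; [apply: Azy|apply: zy]; lia.
- apply: (V (z 0)) => i im; split; last by apply: zx; lia.
  by case: i im => [|i] im; [apply: Azy|apply: zy]; lia.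
- by apply: (V (z n.+1)) => i im; split; [apply: yz|apply: xz]; lia.
Qed.

(** If [e1] holds, [w 0] alternates along [z 0, y 0, z 1, ...]. Otherwise [e1 = false] excludes the
    last two alternatives of [pair_cases] for [w] and [z]. *)
Lemma above_has_B n m e1 e2 (beta : bool) y z w : 2 * n + 1 < m ->
  arcs true z z m -> arcs true y y m -> arcs true z y m -> arcs true y z m ->
  arcs e1 w z m -> arcs e2 z w m ->
  (forall i j, i < j -> j < m -> edge (w i) (w j) = beta) ->
  (forall i, i < m -> edge (w i) (z i)) -> (forall i, i < m -> edge (z i) (y i)) ->
  (forall i j, i < m -> j < m -> edge (y i) (w j)) ->
  has_B n.
Proof.
move=> le zz yy zy yz wz zw ww Awz Azy yw.
have le2 : 2 * n <= m by lia.
have len : n <= m by lia.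
case: e1 wz => wz.
  apply: (@has_V n (w 0) z y); try exact: arcs_le len _.
  move=> i im; split; [apply: Azy; lia| |apply: yw; lia].
  by case: i im => [|i] im; [apply: Awz; lia|apply: wz; lia].
(* A false [beta] alone would permit [w i = w j]; the edges [z j -> w i] and [w j -> z j] exclude
   it. *)
have ww' : arcs beta w w m.
  move=> i j ij jm; rewrite -(ww i j ij jm) (_ : (if _ then _ else _) = true) //.
  case e: (edge (w i) (w j)) => //; rewrite edgeN ?e //.
  apply/eqP => eij; have := wz i j ij jm; rewrite eij => h.
  by have := Awz j jm; rewrite (edge_asym h).
by have [|[]|[<-]] := pair_cases le2 ww' zz wz zw Awz.
Qed.

(** Dual to [above_has_B], with [w n] in place of [w 0], since the edges [z i -> w j] come with
    [i < j]. *)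
Lemma below_has_B n m e1 e2 (beta : bool) x z w : 2 * n + 1 < m ->
  arcs true x x m -> arcs true z z m -> arcs true x z m -> arcs true z x m ->
  arcs e1 z w m -> arcs e2 w z m ->
  (forall i j, i < j -> j < m -> edge (w i) (w j) = beta) ->
  (forall i, i < m -> edge (z i) (w i)) -> (forall i, i < m -> edge (x i) (z i)) ->
  (forall i j, i < m -> j < m -> edge (w j) (x i)) ->
  has_B n.
Proof.
move=> le xx zz xz zx zw wz ww Azw Axz wx.
have le2 : 2 * n <= m by lia.
have len : n <= m by lia.
case: e1 zw => zw.
  apply: (@has_V n (w n) x z); try exact: arcs_le len _.
  by move=> i im; split; [apply: Axz|apply: wx|apply: zw]; lia.
have ww' : arcs beta w w m.
  move=> i j ij jm; rewrite -(ww i j ij jm) (_ : (if _ then _ else _) = true) //.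
  case e: (edge (w i) (w j)) => //; rewrite edgeN ?e //.
  apply/eqP => eij; have := zw i j ij jm; rewrite -eij => h.
  by have := Azw i (ltn_trans ij jm); rewrite (edge_asym h).
by have [|[]|[_]] := pair_cases le2 zz ww' zw wz Azw.
Qed.

End Sequences.

(** * Ramsey's theorem for colourings of ordered pairs *)

Lemma pigeonhole (A : Type) (K : finType) N (r : A -> K) (s : seq A) :
  #|K| * N < size s -> exists k, N <= count (fun a => r a == k) s.
Proof.
move=> lt; case: (boolP [exists k, N <= count (fun a => r a == k) s]) => [/existsP//|].
rewrite negb_exists => /forallP H; exfalso; move: lt; rewrite ltnNge => /negP; apply.
have -> : size s = \sum_k count (fun a => r a == k) s.
  elim: s {H} => [|a s IH] /=; first by rewrite big1.
  by rewrite big_split /= -IH (bigD1 (r a)) //= eqxx big1 // => k /negPf; rewrite eq_sym => ->.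
apply: (@leq_trans (\sum_(k in K) N)); last by rewrite sum_nat_const.
by apply: leq_sum => k _; rewrite ltnW // ltnNge.
Qed.

(** Each element is stored with the colour of its pairs with all later ones: keep the head, restrict
    the tail to one colour by the pigeonhole principle, and recurse. *)
Lemma end_homogeneous (K : finType) L : exists N, forall (c : nat -> nat -> K) (s : seq nat),
  N <= size s -> exists t : seq (nat * K),
  [/\ subseq (map fst t) s, size t = L & pairwise (fun p q => c p.1 q.1 == p.2) t].
Proof.
elim: L => [|L [N IH]]; first by exists 0 => c s _; exists [::]; rewrite sub0seq.
exists (#|K| * N).+2 => c [//|x s] /= /pigeonhole lt.
have [k lek] := lt (c x).
have [|t [ts tL tp]] := IH c [seq y <- s | c x y == k]; first by rewrite size_filter.
exists ((x, k) :: t); split=> //=; last 1 first.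
- rewrite tp andbT; apply/allP => p pt /=.
  have : p.1 \in [seq y <- s | c x y == k] by apply: (mem_subseq ts); apply: map_f.
  by rewrite mem_filter => /andP[].
- by rewrite eqxx; apply: subseq_trans ts (filter_subseq _ _).
- by rewrite tL.
Qed.

(** A second pigeonhole, on the stored colours, makes the colour constant. *)
Lemma ramsey (K : finType) m : exists N, forall c : nat -> nat -> K, exists h k,
  (forall i, i < m -> h i < N) /\
  (forall i j, i < j -> j < m -> h i < h j /\ c (h i) (h j) = k).
Proof.
have [N HN] := end_homogeneous K (#|K| * m).+1.
exists N => c; have [|t [ts tL tp]] := HN c (iota 0 N); first by rewrite size_iota.
have [k lek] : exists k, m <= count (fun p : nat * K => p.2 == k) t.
  by apply: pigeonhole; rewrite tL.
pose t' := [seq p <- t | p.2 == k].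
have st' : m <= size t' by rewrite size_filter.
have t'p : pairwise (fun p q => c p.1 q.1 == p.2) t'.
  exact: subseq_pairwise (filter_subseq _ _) tp.
have t's : subseq (map fst t') (iota 0 N).
  by apply: subseq_trans ts; apply: map_subseq; apply: filter_subseq.
have t'l : pairwise (fun p q => p.1 < q.1) t'.
  rewrite -(pairwise_map fst ltn); apply: subseq_pairwise t's _.
  by rewrite -(sorted_pairwise ltn_trans) iota_ltn_sorted.
pose d := (0, k); exists (fun i => (nth d t' i).1), k.
have sz i : i < m -> i < size t' by move=> im; apply: leq_trans st'.
split=> [i im|i j ij jm].
  have /(mem_subseq t's) : (nth d t' i).1 \in map fst t' by apply/map_f/mem_nth/sz.
  by rewrite mem_iota.
have im := ltn_trans ij jm.
split; first exact: (pairwiseP d t'l) (sz _ im) (sz _ jm) ij.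
have /eqP-> := pairwiseP d t'p _ _ (sz _ im) (sz _ jm) ij.
by have := mem_nth d (sz _ im); rewrite mem_filter => /andP[/eqP].
Qed.

Lemma finite_choice (A : Type) (a : A) m (P : nat -> A -> Prop) :
  (forall i, i < m -> exists y, P i y) -> exists f, forall i, i < m -> P i (f i).
Proof.
elim: m => [|m IH] H; first by exists (fun=> a).
have [f fP] := IH (fun i im => H i (ltnW im)); have [y yP] := H m (ltnSn m).
exists (fun i => if i == m then y else f i) => i im.
have [->//|ne] := eqVneq i m; apply: fP; lia.
Qed.

(** * Transitive chains and their maximality *)

Lemma transitive_chain m : exists N, forall T : tournament, N <= #|T| ->
  exists D : nat -> T, arcs true D D m.
Proof.
have [N HN] := ramsey bool m; exists N.+1 => T leN.
have /card_gt0P[x0 _] : 0 < #|T| by apply: leq_trans leN.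
pose e i := nth x0 (enum T) i.
have eI i j : i < N -> j < N -> i != j -> e i != e j.
  move=> iN jN; have sz l : l < N -> l < size (enum T).
    by rewrite -cardE => lN; apply: ltn_trans leN.
  by rewrite nth_uniq ?sz // enum_uniq.
have [h [b [hN H]]] := HN (fun i j => edge (e i) (e j)).
have A : arcs b (fun i => e (h i)) (fun i => e (h i)) m.
  move=> i j ij jm; have [hij E] := H i j ij jm.
  case: b E {H} => // E; rewrite edgeN ?E // eI ?hN //; first exact: ltn_trans jm.
  by rewrite neq_ltn hij.
case: b {H} A => A; first by exists (fun i => e (h i)).
by exists (fun i => e (h (m.-1 - i))); apply: arcs_rev A.
Qed.

Lemma chain_le_card (T : tournament) (D : nat -> T) m : arcs true D D m -> m <= #|T|.
Proof.
move=> A; rewrite -(card_ord m) -(@card_in_imset _ _ (fun i : 'I_m => D i) 'I_m).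
  by apply: subset_leq_card; apply/subsetP.
move=> i j _ _ e; apply: val_inj; case: (ltngtP i j) => // ij.
  by have := A _ _ ij (ltn_ord j); rewrite e edge_irr.
by have := A _ _ ij (ltn_ord i); rewrite e edge_irr.
Qed.

(* The vertex D k prevents the insertion of z in the chain D at position p. *)
Definition blocks (T : tournament) (D : nat -> T) z p k :=
  ~~ (if k < p then edge (D k) z else edge z (D k)).

(** An unblocked vertex can be inserted and lengthens the chain; the bound [#|T|] on its length ends
    the process. *)
Lemma maximal_chain (T : tournament) (D : nat -> T) m : arcs true D D m ->
  exists M (D' : nat -> T), [/\ m <= M, arcs true D' D' M &
    forall z p, p <= M -> exists2 k, k < M & blocks D' z p k].
Proof.
have [d] := ubnP (#|T|.+1 - m); elim: d => // d IH in m D * => lt A.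
have := chain_le_card A => mT.
case: (boolP [forall z, forall p : 'I_m.+1, exists k : 'I_m, blocks D z p k]) => [H|].
  exists m, D; split=> // z p; rewrite -ltnS => pm.
  by have /forallP/(_ (Ordinal pm))/existsP[k kb] := forallP H z; exists k.
rewrite negb_forall => /existsP[z]; rewrite negb_forall => /existsP[p].
rewrite negb_exists => /forallP H.
pose E i := if i < p then D i else if i == p :> nat then z else D i.-1.
have pm := ltn_ord p.
have Hk k : k < m -> if k < p then edge (D k) z else edge z (D k).
  by move=> km; have := H (Ordinal km); rewrite /blocks negbK.
have [|i j ij jm|M [D' [mM A' B]]] := IH m.+1 E; last by exists M, D'; split=> //; apply: ltnW.
  by lia.
rewrite /E; case: (ltngtP i p) => ip; case: (ltngtP j p) => jp; try lia.
- by apply: A; lia.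
- by apply: A; lia.
- by have := Hk i; rewrite ip; apply; lia.
- by apply: A; lia.
- have := Hk j.-1; have -> : (j.-1 < p) = false by lia.
  by apply; lia.
Qed.

(** * Separators of consecutive chain vertices *)

(** A pair spans no 3-cycle, so indecomposability keeps it from being autonomous. *)
Lemma separator (T : tournament) (x y : T) : acyclically_indecomposable T -> edge x y ->
  exists z, edge y z /\ edge z x \/ edge x z /\ edge z y.
Proof.
move=> AI xy; have xNy := edge_neq xy.
have : ~~ acyclic_autonomous [set x; y].
  by apply/negP => /AI; rewrite cards2 xNy.
rewrite negb_and negbK => /orP[|/existsP[a /existsP[b /existsP[c]]]]; last first.
  rewrite /= /sub_edge; case: a b c => [a +] [b +] [c +] /=.
  rewrite !inE => /orP[]/eqP-> /orP[]/eqP-> /orP[]/eqP->;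
  by rewrite ?edge_irr ?xy ?(edge_asym xy) ?andbF.
rewrite /autonomous negb_forall => /existsP[z]; rewrite negb_imply !inE !negb_or.
case/andP=> /andP[zx zy] /andP[h1 h2]; exists z.
case ezx: (edge z x); case ezy: (edge z y).
- case/negP: h1; apply/forall_inP => t; by rewrite !inE => /orP[]/eqP->.
- by left; rewrite (edgeN zy) ezy.
- by right; rewrite (edgeN zx) ezx.
- case/negP: h2; apply/forall_inP => t.
  by rewrite !inE => /orP[]/eqP->; rewrite ?(edgeN zx) ?(edgeN zy) ?ezx ?ezy.
Qed.

(** The blocking vertex is stored as its position [k] in [D], so that it can be compared with the
    rest of the chain. *)
Definition obstruction (T : tournament) (D : nat -> T) M i (s : T * nat) :=
  let: (z, k) := s in let x := D (2 * i) in let y := D (2 * i).+1 in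
  [/\ forall j, j < M -> z != D j, k < M &
    if edge y z then edge z x else
    [&& edge x z, edge z y & if (2 * i).+1 < k then edge (D k) z
                             else (k < 2 * i) && edge z (D k)]].

Lemma obstruction_exists (T : tournament) (D : nat -> T) M i :
  acyclically_indecomposable T -> arcs true D D M ->
  (forall z p, p <= M -> exists2 k, k < M & blocks D z p k) ->
  (2 * i).+1 < M -> exists s, obstruction D M i s.
Proof.
move=> AI A B iM.
have [z zP] := separator AI (A (2 * i) (2 * i).+1 (ltnSn _) iM).
(* Any other vertex of [D] lies before both [x] and [y] or after both, so it does not separate
   them. *)
have zD j : j < M -> z != D j.
  move=> jM; apply/eqP => ez; subst z; have [?|?] : j <= 2 * i \/ (2 * i).+1 <= j by lia.
    have yj : edge (D j) (D (2 * i).+1) by apply: A; lia.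
    have [ej|ne] := eqVneq j (2 * i).
      by subst j; case: zP => -[]; rewrite edge_irr.
    have xj : edge (D j) (D (2 * i)) by apply: A; lia.
    by case: zP => -[]; rewrite (edge_asym yj, edge_asym xj).
  have xj : edge (D (2 * i)) (D j) by apply: A; lia.
  have [ej|ne] := eqVneq j (2 * i).+1.
    by subst j; case: zP => -[]; rewrite edge_irr.
  have yj : edge (D (2 * i).+1) (D j) by apply: A; lia.
  by case: zP => -[] ? h; move: h; rewrite (edge_asym yj, edge_asym xj).
case: zP => -[e1 e2]; first by exists (z, 0); split=> //; [lia|rewrite e1].
(* This position lies between [x] and [y]; as [x -> z -> y], neither of them blocks, so [k] is
   outside the pair. *)
have [k kM] := B z (2 * i).+1 (ltnW iM); rewrite /blocks => kb.
exists (z, k); split=> //; rewrite (edge_asym e2) e1 e2 /=.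
case: ltnP => ki.
  by move: kb; rewrite ltnNge (ltnW ki) /= => /negPf kb; rewrite edgeN ?zD // kb.
have ki' : k != (2 * i).+1 by apply/eqP => ek; move: kb; rewrite ek ltnn e2.
have kl : k < (2 * i).+1 by lia.
have ki2 : k != 2 * i by apply/eqP => ek; move: kb; rewrite ek ltnSn e1.
apply/andP; split; first lia.
by move: kb; rewrite kl => /negPf kb; rewrite edgeN ?kb // eq_sym zD.
Qed.

(** * Homogeneous sequences and the final case analysis *)

Lemma homogeneous_arcs (T : tournament) (u v : nat -> T) m b :
  (forall i j, i < j -> j < m -> edge (u i) (v j) = b) ->
  (forall i j, i < j -> j < m -> u i != v j) -> arcs b u v m.
Proof.
move=> H ne i j ij jm; have := H i j ij jm.
by case: b {H} => // e; rewrite edgeN ?e // ne.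
Qed.

Lemma arcs_chain (T : tournament) (D : nat -> T) M (f g : nat -> nat) m : arcs true D D M ->
  (forall i j, i < j -> j < m -> f i < g j /\ g j < M) ->
  arcs true (fun i => D (f i)) (fun i => D (g i)) m.
Proof. by move=> A H i j ij jm; have [fg gM] := H i j ij jm; apply: A. Qed.

Lemma arcs_succ (T : tournament) (u v : nat -> T) b m :
  arcs b u v m -> arcs b (fun i => u i.+1) (fun i => v i.+1) m.-1.
Proof. by move=> A i j ij jm; apply: A; lia. Qed.

(** Entries 0 and 1 give the type of the obstruction at [i], entries 11 and 12 the place of each [w]
    relative to the other pair. Entries 2 and 3 record both directions because [z i] and [z j] may
    coincide. *)
Definition pattern (T : tournament) (D z : nat -> T) (k : nat -> nat) (i j : nat) :=
  let x i := D (2 * i) in let y i := D (2 * i).+1 in let w i := D (k i) in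
  [tuple edge (y i) (z i); (2 * i).+1 < k i; edge (z i) (z j); edge (z j) (z i);
         edge (x i) (z j); edge (z i) (x j); edge (y i) (z j); edge (z i) (y j);
         edge (w i) (z j); edge (z i) (w j); edge (w i) (w j);
         k i < 2 * j; (2 * i).+1 < k j].

Theorem theorem1p3 : forall n : nat, exists a : nat, forall T : tournament,
  acyclically_indecomposable T -> a <= #|T| ->
  exists2 B : tournament, frakB n B & contains T (check B).
Proof.
move=> n.
(* The last case drops the index 0 and requires [2 * n + 1 < m.-1]. *)
pose m := 2 * n + 3.
(* The extra index [m] is the partner that makes the bits depending on [i] alone constant for
   [i < m]. *)
have [N HN] := ramsey (13.-tuple bool) m.+1.
have [a Ha] := transitive_chain (2 * N).+1.
exists a => T AI /Ha[D0 /maximal_chain[M [D [NM DD maxD]]]].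
have [s sP] : exists s, forall i, i < N -> obstruction D M i (s i).
  apply: (finite_choice (D 0, 0)) => i iN; apply: obstruction_exists => //; lia.
pose z0 i := (s i).1; pose k0 i := (s i).2.
have [h [c [hN hc]]] := HN (pattern D z0 k0).
have hM i : i <= m -> (2 * h i).+1 < M by move=> im; have := hN i im; lia.
have hlt i j : i < j -> j <= m -> h i < h j by move=> ij jm; case: (hc i j ij jm).
have bit p i j : i < j -> j <= m -> nth false (pattern D z0 k0 (h i) (h j)) p = nth false c p.
  by move=> ij jm; case: (hc i j ij jm) => _ ->.
pose x i := D (2 * h i); pose y i := D (2 * h i).+1.
pose z i := z0 (h i); pose k i := k0 (h i); pose w i := D (k i).
have ob i : i <= m -> [/\ forall j, j < M -> z i != D j, k i < M &
    if edge (y i) (z i) then edge (z i) (x i) else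
    [&& edge (x i) (z i), edge (z i) (y i) & if (2 * h i).+1 < k i then edge (w i) (z i)
                             else (k i < 2 * h i) && edge (z i) (w i)]].
  by move=> im; have := sP _ (hN i im); rewrite /obstruction /z /w /k /z0 /k0; case: (s _).
have kM i : i <= m -> k i < M by case/ob.
have [[xx yy] [xy yx]] : (arcs true x x m.+1 /\ arcs true y y m.+1) /\
    (arcs true x y m.+1 /\ arcs true y x m.+1).
  by do 2!split; apply: (arcs_chain DD) => i j ij jm;
    have := hlt i j ij jm; have := hM j jm; lia.
have xyE i : i <= m -> edge (x i) (y i) by move=> im; apply: DD; [lia|apply: hM].
have zD i j : i <= m -> j < M -> z i != D j by case/ob => H _ _; apply: H.
have zDarcs (e : bool) f : (forall i, i <= m -> f i < M) ->
    (forall i j, i < j -> j <= m -> edge (z i) (D (f j)) = e) ->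
    arcs e z (fun i => D (f i)) m.+1.
  move=> fM H; apply: homogeneous_arcs => // i j ij jm; apply: zD; [lia|exact: fM].
have Dzarcs (e : bool) f : (forall i, i <= m -> f i < M) ->
    (forall i j, i < j -> j <= m -> edge (D (f i)) (z j) = e) ->
    arcs e (fun i => D (f i)) z m.+1.
  move=> fM H; apply: homogeneous_arcs => // i j ij jm.
  by rewrite eq_sym zD //; apply: fM; lia.
have xM i : i <= m -> 2 * h i < M by move/hM/ltnW.
have xz := Dzarcs _ _ xM (bit 4).
have zx := zDarcs _ _ xM (bit 5).
have yz := Dzarcs _ _ hM (bit 6).
have zy := zDarcs _ _ hM (bit 7).
have wz := Dzarcs _ _ kM (bit 8).
have zw := zDarcs _ _ kM (bit 9).
have ww := bit 10.
have tA i : i < m -> edge (y i) (z i) = nth false c 0 by move=> im; apply: (bit 0 _ m).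
have tU i : i < m -> ((2 * h i).+1 < k i) = nth false c 1 by move=> im; apply: (bit 1 _ m).
have kb i j : i < j -> j <= m -> (k i < 2 * h j) = nth false c 11 by apply: (bit 11).
have kb' i j : i < j -> j <= m -> ((2 * h i).+1 < k j) = nth false c 12 by apply: (bit 12).
have ob' i : i < m -> if nth false c 0 then edge (z i) (x i) else
    [&& edge (x i) (z i), edge (z i) (y i) & if nth false c 1 then edge (w i) (z i)
                             else (k i < 2 * h i) && edge (z i) (w i)].
  by move=> im; have [_ _] := ob i (ltnW im); rewrite tA // tU.
have lem (u v : nat -> T) b : arcs b u v m.+1 -> arcs b u v m by apply: arcs_le.
have lenS (u v : nat -> T) b : arcs b u v m.+1 -> arcs b u v n by apply: arcs_le; lia.
(* If bits 2 and 3 are both false, [z] is constant and alternates along the chain, which gives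
   [V]. *)
have [zc|[b zz]] : (forall i, i <= m -> z i = z 0) \/ exists b, arcs b z z m.+1.
  have zz := bit 2; have zz' := bit 3; rewrite /= in zz zz'.
  case: (nth false c 2) zz => zz.
    by right; exists true => i j ij jm; apply: zz.
  case: (nth false c 3) zz' => zz'.
    by right; exists false => i j ij jm; apply: zz'.
  left=> -[//|i] im; apply/eqP; apply: contraT => /edge_complete.
  by rewrite [edge (z i.+1) _]zz' // [edge (z 0) _]zz.
- case: (nth false c 0) tA ob' => tA ob'.
    apply: (@has_V _ n (z 0) x y); try exact: lenS.
    move=> i im; have im' : i < m by lia.
    rewrite -(zc i (ltnW im')); split; first exact: xyE (ltnW im').
      exact: ob'.
    by rewrite tA.
  apply: (@has_V _ n (z 0) y (fun i => x i.+1)); try exact: lenS.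
  - by move=> i j ij jn; apply: xx; lia.
  - by move=> i j ij jn; apply: yx; lia.
  - move=> i j ij jn; have [->|ne] := eqVneq i.+1 j; first by apply: xyE; lia.
    by apply: xy; lia.
  move=> i im; have im' : i.+1 < m by lia.
  split; first by apply: yx; lia.
    by rewrite -(zc i) 1?ltnW 1?ltnW //; have /and3P[] := ob' i (ltnW im').
  by rewrite -(zc i.+1) 1?ltnW //; have /and3P[] := ob' i.+1 im'.
(* If [y i -> z i], each triple [x i, y i, z i] is a 3-cycle. *)
case: (nth false c 0) tA ob' => tA ob'.
  apply: (@cycle_has_B _ n m _ _ _ _ _ x y z); first (by lia); try exact: lem;
    [exact: lem zz|exact: lem yz|exact: lem zy|exact: lem zx|exact: lem xz|].
  by move=> i im; split; [apply: xyE; lia|rewrite tA|apply: ob'].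
have xzE i : i < m -> edge (x i) (z i) by move=> /ob'/and3P[].
have zyE i : i < m -> edge (z i) (y i) by move=> /ob'/and3P[].
have [|//|] := @between_cases _ n m _ _ _ _ _ x y z _ (lem _ _ _ xx) (lem _ _ _ yy)
  (lem _ _ _ xy) (lem _ _ _ yx) (lem _ _ _ zz) (lem _ _ _ xz) (lem _ _ _ zx)
  (lem _ _ _ zy) (lem _ _ _ yz) (fun i im => xyE i (ltnW im)) xzE zyE; first by lia.
case/and5P=> bT xzT zxT zyT yzT; rewrite ?bT ?xzT ?zxT ?zyT ?yzT in zz xz zx zy yz.
(* Now [z] interleaves with the chain, and [w i] lies either above [y i] or below [x i]. *)
case: (nth false c 1) tU ob' => tU ob'.
  have wzE i : i < m -> edge (w i) (z i) by move=> /ob'/and3P[].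
  have ywE i : i < m -> edge (y i) (w i).
    by move=> im; apply: DD; [rewrite tU|apply: kM; lia].
  (* Either [w i] precedes every later [x j], and [y, w, z] form 3-cycles, or every [w j] with
     [j < m] is at or above [x m], hence above all [y i] with [i < m]. *)
  case: (nth false c 11) kb => kb.
    apply: (@cycle_has_B _ n m true _ _ true true y w z); first (by lia); try exact: lem.
    - apply: (arcs_chain DD) => i j ij jm; have := kb i j ij (ltnW jm).
      by have := tU j jm; have := kM j (ltnW jm); lia.
    - apply: (arcs_chain DD) => i j ij jm; have := hlt i j ij (ltnW jm).
      by have := tU j jm; have := kM j (ltnW jm); lia.
    - apply: (arcs_chain DD) => i j ij jm; have := kb i j ij (ltnW jm).
      by have := hM j (ltnW jm); lia.
    - exact: lem wz.
    - exact: lem zw.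
    by move=> i im; split; [apply: ywE|apply: wzE|apply: zyE].
  apply: (@above_has_B _ n m _ _ (nth false c 10) y z w); first (by lia); try exact: lem.
  - exact: lem wz.
  - exact: lem zw.
  - by move=> i j ij jm; apply: ww; lia.
  - exact: wzE.
  - exact: zyE.
  move=> i j im jm; apply: DD; last by apply: kM; lia.
  by have := kb j m jm (leqnn m); have := hlt i m im (leqnn m); lia.
have zwE i : i < m -> edge (z i) (w i) by move=> /ob'/and3P[_ _ /andP[]].
have kx i : i < m -> k i < 2 * h i by move=> /ob'/and3P[_ _ /andP[]].
have wxE i : i < m -> edge (w i) (x i) by move=> im; apply: DD; [apply: kx|apply: xM; lia].
(* Dually, either [w j] follows every earlier [y i], and [w, x, z] form 3-cycles, or every [w j]
   with [0 < j] is at or below [y 0]. *)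
case: (nth false c 12) kb' => kb'.
  apply: (@cycle_has_B _ n m true true true _ _ w x z); first (by lia); try exact: lem.
  - apply: (arcs_chain DD) => i j ij jm; have := kb' i j ij (ltnW jm).
    by have := kx i; have := kM j (ltnW jm); lia.
  - apply: (arcs_chain DD) => i j ij jm; have := hlt i j ij (ltnW jm).
    by have := kx i; have := hM j (ltnW jm); lia.
  - apply: (arcs_chain DD) => i j ij jm; have := kb' i j ij (ltnW jm).
    by have := kM j (ltnW jm); lia.
  - exact: lem zw.
  - exact: lem wz.
  by move=> i im; split; [apply: wxE|apply: xzE|apply: zwE].
(* Dropping the index 0 puts all the remaining x i above all the w j. *)
pose up (u : nat -> T) i := u i.+1.
apply: (@below_has_B _ n m.-1 _ _ (nth false c 10) (up x) (up z) (up w)); first (by lia);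
  try by apply: arcs_succ; apply: lem.
- by apply: arcs_succ; apply: lem zw.
- by apply: arcs_succ; apply: lem wz.
- by move=> i j ij jm; apply: ww; lia.
- by move=> i im; apply: zwE; lia.
- by move=> i im; apply: xzE; lia.
move=> i j im jm; apply: DD; last by apply: xM; lia.
by have := kb' 0 j.+1; have := hlt 0 i.+1; lia.
Qed.
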